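(* Let $P\in\mathbb{F}_{q^r}[X,\sigma]$ be nonzero. Then the similarity classes of irreducible factors of $P$ appear in all possible orders in the factorizations of $P$; that is, if $P=P_1P_2\cdots P_n$ is a factorization of $P$ as a product of irreducible skew polynomials, then for every permutation $\tau$ of $\{1,\dots,n\}$ there is a factorization $P=Q_1Q_2\cdots Q_n$ into irreducible skew polynomials such that $Q_i$ is similar to $P_{\tau(i)}$ for all $1\le i\le n$.
   Context: Let $p$ be a prime, $q=p^a$ a power of $p$, $r\ge 1$, $\sigma(x)=x^q$ on $\mathbb{F}_{q^r}$. $\mathbb{F}_{q^r}[X,\sigma]$ is the skew polynomial ring with $X\cdot c=\sigma(c)\cdot X$ for $c\in\mathbb{F}_{q^r}$. A skew polynomial $A$ is a right-divisor of $B$ (and $B$ a left-multiple of $A$) if $B=UA$ for some skew polynomial $U$. The right greatest common divisor (rgcd) and left lowest common multiple (llcm) are defined accordingly (up to nonzero left constants). Two skew polynomials $A,B$ are similar if there exists a skew polynomial $U$ such that the rgcd of $U$ and $A$ is $1$ and $BU$ is the llcm of $U$ and $A$. Similarity is an equivalence relation. *)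

(* Defs.v *)
From HB Require Import structures.
From mathcomp Require Import all_boot all_order all_algebra.

Set Implicit Arguments.
Unset Strict Implicit.
Unset Printing Implicit Defensive.

Import GRing.Theory.
Local Open Scope ring_scope.

(* R[X, s], with X * c = s c * X.  The additive group is that of {poly R},    *)
(* coefficients being written on the left of the powers of X; the ring        *)
(* structure installed below is the twisted one, although the carrier is      *)
(* convertible to {poly R}.                                                   *)
Definition skew_poly (R : nzRingType) (s : {rmorphism R -> R}) := {poly R}.

Section SkewPolyRing.

Variables (R : nzRingType) (s : {rmorphism R -> R}).
Implicit Types A B C : {poly R}.

Definition skew_mul A B : {poly R} :=
  \poly_(i < size A + size B) \sum_(j < i.+1) A`_j * iter j s B`_(i - j).

Lemma iter_rmorph0 n : iter n s 0 = 0.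
Proof. by elim: n => //= n ->; rewrite rmorph0. Qed.

Lemma iter_rmorph1 n : iter n s 1 = 1.
Proof. by elim: n => //= n ->; rewrite rmorph1. Qed.

Lemma iter_rmorphD n x y : iter n s (x + y) = iter n s x + iter n s y.
Proof. by elim: n => //= n ->; rewrite rmorphD. Qed.

Lemma iter_rmorphM n x y : iter n s (x * y) = iter n s x * iter n s y.
Proof. by elim: n => //= n ->; rewrite rmorphM. Qed.

Lemma iter_rmorph_sum n (I : Type) (r : seq I) (P : pred I) (F : I -> R) :
  iter n s (\sum_(i <- r | P i) F i) = \sum_(i <- r | P i) iter n s (F i).
Proof. exact: (big_morph _ (iter_rmorphD n) (iter_rmorph0 n)). Qed.

Lemma coef_skew_mul A B i :
  (skew_mul A B)`_i = \sum_(j < i.+1) A`_j * iter j s B`_(i - j).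
Proof.
rewrite coef_poly; case: ltnP => // le_i; rewrite big1 // => j _.
have [lt_j|le_j] := ltnP j (size A); last by rewrite nth_default ?mul0r.
rewrite [B`__]nth_default ?iter_rmorph0 ?mulr0 //.
rewrite leq_subRL -1?ltnS //; apply: leq_trans le_i.
by rewrite leq_add2r ltnW.
Qed.

Lemma coef_skew_mul_rev A B i :
  (skew_mul A B)`_i = \sum_(j < i.+1) A`_(i - j) * iter (i - j) s B`_j.
Proof.
rewrite coef_skew_mul (reindex_inj rev_ord_inj) /=.
by apply: eq_bigr => j _; rewrite (sub_ordK j).
Qed.

Fact skew_mulA : associative skew_mul.
Proof.
move=> A B C; apply/polyP=> i; rewrite coef_skew_mul coef_skew_mul_rev.
pose c3 j k := A`_j * (iter j s B`_(i - j - k) * iter (i - k) s C`_k).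
transitivity (\sum_(j < i.+1) \sum_(k < i.+1 | (k <= i - j)%N) c3 j k).
  apply: eq_bigr => /= j _.
  rewrite coef_skew_mul_rev iter_rmorph_sum big_distrr /=.
  rewrite (big_ord_narrow_leq (leq_subr _ _)); apply: eq_bigr => k _ /=.
  rewrite iter_rmorphM -iterD /c3 subnAC subnKC // leq_subRL.
    by rewrite addnC -leq_subRL -ltnS.
  by rewrite (leq_trans _ (leq_subr j i)) // -ltnS.
rewrite (exchange_big_dep predT) //=; apply: eq_bigr => k _.
transitivity (\sum_(j < i.+1 | (j <= i - k)%N) c3 j k).
  apply: eq_bigl => j; rewrite -ltnS -(ltnS j) -!subSn ?leq_ord //.
  by rewrite -subn_gt0 -(subn_gt0 j) -!subnDA addnC.
rewrite (big_ord_narrow_leq (leq_subr _ _)) coef_skew_mul big_distrl /=.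
by apply: eq_bigr => j _; rewrite /c3 -!subnDA addnC mulrA.
Qed.

Fact skew_mul1l : left_id 1%:P skew_mul.
Proof.
move=> A; apply/polyP => i; rewrite coef_skew_mul big_ord_recl subn0.
by rewrite big1 => [|j _]; rewrite coefC /= ?mul0r // mul1r addr0.
Qed.

Fact skew_mul1r : right_id 1%:P skew_mul.
Proof.
move=> A; apply/polyP => i; rewrite coef_skew_mul_rev big_ord_recl subn0.
rewrite big1 => [|j _]; rewrite coefC /= ?iter_rmorph0 ?mulr0 //.
by rewrite iter_rmorph1 mulr1 addr0.
Qed.

Fact skew_mulDl : left_distributive skew_mul +%R.
Proof.
move=> A B C; apply/polyP=> i; rewrite coefD !coef_skew_mul -big_split.
by apply: eq_bigr => j _; rewrite coefD mulrDl.
Qed.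

Fact skew_mulDr : right_distributive skew_mul +%R.
Proof.
move=> A B C; apply/polyP=> i; rewrite coefD !coef_skew_mul -big_split.
by apply: eq_bigr => j _; rewrite coefD iter_rmorphD mulrDr.
Qed.

Fact skew_1_neq0 : 1%:P != 0 :> {poly R}.
Proof. by rewrite polyC_eq0 oner_neq0. Qed.

HB.instance Definition _ := GRing.Zmodule.on (@skew_poly R s).
HB.instance Definition _ := GRing.Zmodule_isNzRing.Build (@skew_poly R s)
  skew_mulA skew_mul1l skew_mul1r skew_mulDl skew_mulDr skew_1_neq0.

Lemma skew_mulXC (c : R) :
  ('X : skew_poly s) * (c%:P : skew_poly s)
  = ((s c)%:P : skew_poly s) * ('X : skew_poly s).
Proof.
apply/polyP => -[|[|i]]; rewrite !coef_skew_mul !big_ord_recl ?big_ord0 /=.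
- by rewrite !coefX !coefC /= mul0r mulr0.
- by rewrite !coefX !coefC /= ?(mul0r, mulr0, mul1r, mulr1, addr0, add0r).
rewrite !big1 => [|j _|j _]; rewrite !coefX !coefC /=.
- by rewrite ?rmorph0 ?(mul0r, mulr0, addr0).
- by rewrite mul0r.
by rewrite mul0r.
Qed.

End SkewPolyRing.

Section Divisibility.

Variable S : nzRingType.
Implicit Types A B D M U : S.

Definition rdvd A B : Prop := exists U, B = U * A.

Definition is_rgcd D A B : Prop :=
  [/\ rdvd D A, rdvd D B & forall E, rdvd E A -> rdvd E B -> rdvd E D].

Definition is_llcm M A B : Prop :=
  [/\ rdvd A M, rdvd B M & forall N, rdvd A N -> rdvd B N -> rdvd M N].

(* U = 0 is allowed; over skew polynomials it only matters when A is a unit,  *)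
(* since is_rgcd 1 0 A says that A is left-invertible.                        *)
Definition ore_similar A B : Prop :=
  exists U, is_rgcd 1 U A /\ is_llcm (B * U) U A.

Definition invertible A : Prop := exists B, A * B = 1 /\ B * A = 1.

Definition irreducible A : Prop :=
  [/\ A <> 0, ~ invertible A
    & forall B C, A = B * C -> invertible B \/ invertible C].

End Divisibility.

(* Main.v *)
Require Import Defs.
From HB Require Import structures.
From Stdlib Require Import Classical.
From Stdlib Require List.
From mathcomp Require Import all_boot all_order all_fingroup all_algebra.
From mathcomp Require Import finfield.

(* Write [S] for the skew polynomial ring.  Similarity of [A] and [B] is
   isomorphism of the left modules [S / S A] and [S / S B], which are simple
   when [A] and [B] are irreducible.  It is enough to rewrite a product [A B]
   of two irreducibles as [B' A'] with [B'] similar to [B] and [A'] to [A],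
   that is, to split [0 -> S / S A -> S / S A B -> S / S B -> 0] when the two
   ends are not isomorphic.  A central element that kills [S / S A] but not
   [S / S B] does this.  It comes from the annihilator of [S / S A], which does
   not kill [S / S B] because the base field is finite, and whose generator is
   central unless [A] is associated to ['X]; in that case a power of ['X] will
   do, ['X] acting injectively on [S / S B]. *)

Set Implicit Arguments.
Unset Strict Implicit.
Unset Printing Implicit Defensive.

Import GRing.Theory.
Local Open Scope ring_scope.

(** Closure under opposites is the case [x = -1] of the last clause. *)
Definition left_ideal (S : nzRingType) (J : S -> Prop) : Prop :=
  [/\ J 0, forall x y, J x -> J y -> J (x + y) & forall x y, J y -> J (x * y)].

Definition left_pid (S : nzRingType) : Prop :=
  (forall x y : S, x * y = 0 -> x = 0 \/ y = 0) /\
  (forall J : S -> Prop, left_ideal J ->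
     exists2 d, J d & forall f, J f -> rdvd d f).

(** * Irreducible elements of a left principal ideal domain *)

Section RightDivisibility.

Variable S : nzRingType.
Implicit Types A B C U f x y : S.

Lemma rdvdd A : rdvd A A. Proof. by exists 1; rewrite mul1r. Qed.

Lemma rdvd_mull x A B : rdvd A B -> rdvd A (x * B).
Proof. by case=> u ->; exists (x * u); rewrite mulrA. Qed.

Lemma rdvd_mulr A x : rdvd A (x * A).
Proof. by exists x. Qed.

Lemma rdvdD A B C : rdvd A B -> rdvd A C -> rdvd A (B + C).
Proof. by case=> u -> [v ->]; exists (u + v); rewrite mulrDl. Qed.

Lemma rdvdB A B C : rdvd A B -> rdvd A C -> rdvd A (B - C).
Proof. by case=> u -> [v ->]; exists (u - v); rewrite mulrBl. Qed.

Lemma rdvd_trans B A C : rdvd A B -> rdvd B C -> rdvd A C.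
Proof. by move=> AB [u ->]; exact: rdvd_mull. Qed.

Lemma rdvd0 A : rdvd A 0. Proof. by exists 0; rewrite mul0r. Qed.

End RightDivisibility.

Section LeftPid.

Variables (S : nzRingType) (pidS : left_pid S).
Implicit Types A B C D U c f x y : S.

Lemma left_pid_cancel A x y : A <> 0 -> x * A = y * A -> x = y.
Proof.
move=> A0 /eqP; rewrite -subr_eq0 -mulrBl => /eqP /(proj1 pidS) [/eqP|//].
by rewrite subr_eq0 => /eqP.
Qed.

Lemma left_inverse_invertible x A : x * A = 1 -> invertible A.
Proof.
move=> xA; exists x; split=> //; apply: (@left_pid_cancel A).
  by move=> A0; move/eqP: xA; rewrite A0 mulr0 eq_sym oner_eq0.
by rewrite -mulrA xA mulr1 mul1r.
Qed.

Lemma irreducible_not_rdvd1 A : irreducible A -> ~ rdvd A 1.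
Proof.
by case=> _ nA _ [x xA]; apply: nA; exact: (@left_inverse_invertible x).
Qed.

(** The left ideal [S U + S A] has a generator [d], and [A = C d]. A unit [C] would make [A] a
    right-divisor of [U], so [d] is the unit. *)
Lemma irreducible_bezout A U :
  irreducible A -> ~ rdvd A U -> exists x y, x * U + y * A = 1.
Proof.
move=> [A0 nA irrA] nAU.
pose J f := exists x y, f = x * U + y * A.
have [|d [x [y dE]] dJ] := proj2 pidS J.
  split; first by exists 0, 0; rewrite !mul0r addr0.
    move=> _ _ [x [y ->]] [z [t ->]]; exists (x + z), (y + t).
    by rewrite !mulrDl addrACA.
  by move=> z _ [x [y ->]]; exists (z * x), (z * y); rewrite mulrDr !mulrA.
have [|C AE] := dJ A; first by exists 0, 1; rewrite mul0r add0r mul1r.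
have [|u UE] := dJ U; first by exists 1, 0; rewrite mul0r addr0 mul1r.
case: (irrA _ _ AE) => [[C' [_ C'C]]|[d' [_ d'd]]].
  case: nAU; exists (u * C').
  by rewrite AE -mulrA (mulrA C') C'C mul1r.
exists (d' * x), (d' * y).
by rewrite -!mulrA -mulrDr -dE.
Qed.

(* The kernel of [f |-> f U], from [S] to [S / S A], is a proper left ideal
   containing the maximal left ideal [S B]. *)
Lemma irreducible_kernel A B U f :
  irreducible B -> ~ rdvd A U -> rdvd A (B * U) ->
  rdvd A (f * U) -> rdvd B f.
Proof.
move=> irrB nAU ABU AfU; apply: NNPP => nBf; apply: nAU.
have [x [y xy]] := irreducible_bezout irrB nBf.
rewrite -[U]mul1r -xy mulrDl -!mulrA.
by apply: rdvdD; exact: rdvd_mull.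
Qed.

(** This is Schur's lemma: [U] on the right-hand side gives a nonzero map [f |-> f U] from [S / S B]
    to [S / S A], and such a map between simple modules is an isomorphism. *)
Lemma ore_similarP A B : irreducible A -> irreducible B ->
  ore_similar A B <-> exists2 U, ~ rdvd A U & rdvd A (B * U).
Proof.
move=> irrA irrB; split=> [[U [[_ _ gcdU] [_ ABU _]]]|[U nAU ABU]].
  exists U => // AU; apply: (irreducible_not_rdvd1 irrA).
  by apply: gcdU => //; exact: rdvdd.
exists U; split; split => //.
- by exists U; rewrite mulr1.
- by exists A; rewrite mulr1.
- move=> E EU EA; have [x [y <-]] := irreducible_bezout irrA nAU.
  by apply: rdvdD; exact: rdvd_mull.
- exact: rdvd_mulr.
move=> _ [f ->] AfU.
have [g ->] := irreducible_kernel irrB nAU ABU AfU.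
by exists g; rewrite mulrA.
Qed.

Lemma ore_similar_refl A : irreducible A -> ore_similar A A.
Proof.
move=> irrA; apply/ore_similarP => //; exists 1.
  exact: irreducible_not_rdvd1.
by rewrite mulr1; exact: rdvdd.
Qed.

Lemma ore_similar_sym A B : irreducible A -> irreducible B ->
  ore_similar A B -> ore_similar B A.
Proof.
move=> irrA irrB /ore_similarP -/(_ irrA irrB) [U nAU ABU].
(* Right multiplication by [x] inverts right multiplication by [U], because [x U] is [1] modulo
   [A]. *)
have [x [y xy]] := irreducible_bezout irrA nAU.
have xUE : x * U = 1 - y * A by rewrite -xy addrK.
apply/ore_similarP => //; exists x.
  case=> g xE; apply: (irreducible_not_rdvd1 irrA).
  rewrite -xy xE -mulrA.
  by apply: rdvdD; [exact: rdvd_mull | exact: rdvd_mulr].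
apply: (irreducible_kernel irrB nAU ABU).
rewrite -mulrA xUE mulrBr mulr1 mulrA.
by apply: rdvdB; [exact: rdvdd | exact: rdvd_mulr].
Qed.

Lemma ore_similar_trans B A C :
  irreducible A -> irreducible B -> irreducible C ->
  ore_similar A B -> ore_similar B C -> ore_similar A C.
Proof.
move=> irrA irrB irrC /ore_similarP -/(_ irrA irrB) [U nAU ABU].
move=> /ore_similarP -/(_ irrB irrC) [V nBV [g CV]].
apply/ore_similarP => //; exists (V * U).
  by move=> AVU; apply: nBV; exact: (irreducible_kernel irrB nAU).
by rewrite mulrA CV -mulrA; exact: rdvd_mull.
Qed.

(* [f |-> f U] induces an isomorphism from [S / S A] to [S / S B]. *)
Lemma irreducible_transfer A B U x y :
  irreducible A -> x * U + y * B = 1 -> ~ rdvd B U -> rdvd B (A * U) ->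
  irreducible B.
Proof.
move=> irrA xy nBU BAU.
have B0 : B <> 0.
  move=> B0; move: BAU => [g]; rewrite B0 mulr0 => /(proj1 pidS) [].
    by case: irrA.
  by move=> U0; apply: nBU; rewrite U0; exact: rdvd0.
split=> //.
- by move=> [B' [_ B'B]]; apply: nBU; exists (U * B'); rewrite -mulrA B'B mulr1.
move=> C D BE; have [|nD] := classic (invertible D); [by right | left].
have nDU : ~ rdvd D U.
  move=> [u UE]; apply: nD; apply: (@left_inverse_invertible (x * u + y * C)).
  by rewrite mulrDl -!mulrA -UE -BE.
have DB : rdvd D B by exists C.
have DE : D = D * x * U + D * y * B by rewrite -!mulrA -mulrDr xy mulr1.
(* [D] right-divides [D x U], so the kernel lemma puts [D x] in [S A]. Since [B] right-divides
   [A U], this puts [D] in [S B], and [B = C D] then makes [C] a unit. *)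
have [g gE] : rdvd A (D * x).
  apply: (irreducible_kernel irrA nDU (rdvd_trans DB BAU)).
  have -> : D * x * U = D - D * y * B by rewrite {2}DE addrK.
  by apply: rdvdB; [exact: rdvdd | exact: rdvd_mull].
have [k kE] : rdvd B D.
  by rewrite DE gE -mulrA; apply: rdvdD; apply: rdvd_mull => //; exact: rdvdd.
apply: (@left_inverse_invertible k).
apply: (@left_pid_cancel D); last by rewrite mul1r -mulrA -BE -kE.
by move=> D0; apply: B0; rewrite BE D0 mulr0.
Qed.

(* [c] kills the submodule [S B / S A B] of [S / S A B] and acts injectively on
   the quotient [S / S B], so that [S / S A B] is the direct sum of the former
   and of the image of [c], which is [S A' / S A B]. *)
Lemma irreducible_swap_central A B c :
  irreducible A -> irreducible B -> (forall f, c * f = f * c) ->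
  rdvd A c -> ~ rdvd B c ->
  exists B' A', [/\ A * B = B' * A', irreducible B', irreducible A',
    ore_similar B' B & ore_similar A' A].
Proof.
move=> irrA irrB cC [a cE] nBc.
pose J f := exists x y, f = x * c + y * (A * B).
have [|A' [x [y A'E]] A'J] := proj2 pidS J.
  split; first by exists 0, 0; rewrite !mul0r addr0.
    move=> _ _ [x [y ->]] [z [t ->]]; exists (x + z), (y + t).
    by rewrite !mulrDl addrACA.
  by move=> z _ [x [y ->]]; exists (z * x), (z * y); rewrite mulrDr !mulrA.
have [|B' ABE] := A'J (A * B).
  by exists 0, 1; rewrite mul0r add0r mul1r.
have [|U cE'] := A'J c; first by exists 1, 0; rewrite mul0r addr0 mul1r.
have cB : B * c = a * (A * B) by rewrite -cC cE mulrA.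
have A0 : A <> 0 by case: irrA.
have B0 : B <> 0 by case: irrB.
have AB0 : A * B <> 0 by move/(proj1 pidS) => [].
have A'0 : A' <> 0 by move=> A'0; rewrite ABE A'0 mulr0 in AB0.
have BBc : rdvd B (B * c) by rewrite -cC; exact: rdvd_mulr.
(* Otherwise [A'] right-divides both [B] and [c], hence [1]: the image of [c] is all of [S / S A B].
   Since [c] kills [S B / S A B] and is injective on the quotient, [S B] equals [S A B] and [A] is a
   unit. *)
have nBA' : ~ rdvd A' B.
  move=> A'B; have [u [v uv]] := irreducible_bezout irrB nBc.
  have [d dA'] : rdvd A' 1.
    rewrite -uv; apply: rdvdD; apply: rdvd_mull => //.
    by rewrite cE'; exact: rdvd_mulr.
  have BE : B = B * d * x * c + B * d * y * A * B.
    by rewrite -!mulrA -!mulrDr -A'E -dA' mulr1.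
  have [g gE] : rdvd B (B * d * x).
    apply: (irreducible_kernel irrB nBc BBc).
    have -> : B * d * x * c = B - B * d * y * A * B by rewrite {2}BE addrK.
    by apply: rdvdB; [exact: rdvdd | exact: rdvd_mulr].
  apply: (irreducible_not_rdvd1 irrA); exists (g * a + B * d * y).
  apply: (@left_pid_cancel B) => //.
  by rewrite mul1r {1}BE gE -(mulrA g) cB !mulrDl !mulrA.
have A'AB : rdvd A' (A * B) by rewrite ABE; exact: rdvd_mulr.
have irrA' : irreducible A'.
  have [u [v uv]] := irreducible_bezout irrB nBc.
  apply: (@irreducible_transfer A A' B v (u * U)) => //.
  by rewrite -mulrA -cE' addrC.
have nB'U : ~ rdvd B' U.
  by move=> [u UE]; apply: nBc; exists (u * A); rewrite -mulrA ABE mulrA -UE.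
have B'BU : rdvd B' (B * U).
  exists a; apply: (@left_pid_cancel A') => //.
  by rewrite -!mulrA -cE' -ABE.
(* The relation [x U + y B' = 1] is the expression of [A'] in terms of [c] and [A B], with [A']
   cancelled on the right. *)
have irrB' : irreducible B'.
  apply: (@irreducible_transfer B B' U x y) => //.
  apply: (@left_pid_cancel A') => //.
  by rewrite mul1r mulrDl -!mulrA -cE' -ABE -A'E.
by exists B', A'; split=> //; apply/ore_similarP => //; [exists U | exists B].
Qed.

(* Since the simple modules [S / S A] and [S / S B] are not isomorphic, no
   submodule of a finite sum of copies of the former maps onto the latter. *)
Lemma not_similar_separated A B (vs : seq S) :
  irreducible A -> irreducible B -> ~ ore_similar B A ->
  exists2 e, ~ rdvd B e & forall v, v \in vs -> rdvd A (e * v).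
Proof.
move=> irrA irrB nBA; elim: vs => [|v vs [e nBe eA]].
  by exists 1 => //; exact: irreducible_not_rdvd1.
suff [g nBge Agev] : exists2 g, ~ rdvd B (g * e) & rdvd A (g * e * v).
  exists (g * e) => // w; rewrite inE => /predU1P [->|/eA] //.
  by rewrite -mulrA; exact: rdvd_mull.
apply: NNPP => ng.
(* Without such a [g], sending [g e v] to [g e] is a well-defined map from [S / S A] to [S / S B].
   The class of [1] is that of [y e v], whence the witness [y e] of similarity below. *)
have sub g : rdvd A (g * e * v) -> rdvd B (g * e).
  by move=> Agev; apply: NNPP => nBge; apply: ng; exists g.
have nAev : ~ rdvd A (e * v).
  by rewrite -[e]mul1r => /sub; rewrite mul1r.
have [y [z yz]] := irreducible_bezout irrA nAev.
have yE : y * (e * v) = 1 - z * A by rewrite -yz addrK.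
apply: nBA; apply/ore_similarP => //; exists (y * e); last first.
  rewrite mulrA; apply: sub; rewrite -!mulrA yE mulrBr mulr1 mulrA.
  by apply: rdvdB; [exact: rdvdd | exact: rdvd_mulr].
move=> Bye; apply: nBe.
(* The factor [1 - e v y] kills [e v] modulo [A], so [sub] applies to it. *)
have -> : e = (1 - e * v * y) * e + e * v * (y * e).
  by rewrite mulrBl mul1r -!mulrA subrK.
apply: rdvdD; last exact: rdvd_mull.
apply: sub; rewrite !mulrBl mul1r.
have -> : e * v * y * e * v = e * v * (y * (e * v)) by rewrite !mulrA.
by rewrite yE mulrBr mulr1 opprB addrC subrK mulrA; exact: rdvd_mulr.
Qed.

End LeftPid.

(** * Euclidean division of skew polynomials *)

Section SkewDivision.

Variables (F : fieldType) (s : {rmorphism F -> F}).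
Implicit Types A B f : skew_poly s.
Local Notation sz A := (size (A%R : {poly F})).

Lemma iter_rmorph_eq0 n x : (iter n s x == 0) = (x == 0).
Proof. by elim: n => //= n <-; rewrite fmorph_eq0. Qed.

(** Degree bounds, not exact degrees, suffice: only the term of index [a] survives in the
    convolution. *)
Lemma coef_skew_mul_top A B a b :
  (sz A <= a.+1)%N -> (sz B <= b.+1)%N ->
  (A * B : {poly F})`_(a + b) = A`_a * iter a s B`_b.
Proof.
move=> sA sB; rewrite [LHS](coef_skew_mul s).
have lt_a : (a < (a + b).+1)%N by rewrite ltnS leq_addr.
rewrite (bigD1 (Ordinal lt_a)) //= addKn big1 ?addr0 // => j.
rewrite -val_eqE /= neq_ltn => /orP[lt_ja|lt_aj].
  rewrite [B`__]nth_default ?iter_rmorph0 ?mulr0 //.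
  apply: (leq_trans sB); rewrite -addnBAC ?(ltnW lt_ja) //.
  by rewrite -[leqLHS]add1n leq_add2r subn_gt0.
by rewrite nth_default ?mul0r //; apply: (leq_trans sA).
Qed.

Lemma size_skew_mul_leq A B a b :
  (sz A <= a.+1)%N -> (sz B <= b.+1)%N ->
  (sz (A * B) <= (a + b).+1)%N.
Proof.
move=> sA sB; apply/leq_sizeP => i lt_i; rewrite [LHS](coef_skew_mul s).
apply: big1 => j _; have [le_ja|lt_aj] := leqP j a.
  rewrite [B`__]nth_default ?iter_rmorph0 ?mulr0 //.
  apply: (leq_trans sB); rewrite leq_subRL; last by rewrite -ltnS.
  by rewrite addnS (leq_ltn_trans _ lt_i) // leq_add2r.
by rewrite nth_default ?mul0r //; apply: (leq_trans sA).
Qed.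

Lemma skew_mul_coef_neq0 A B : A <> 0 -> B <> 0 ->
  (A * B : {poly F})`_((sz A).-1 + (sz B).-1) != 0.
Proof.
move=> /eqP A0 /eqP B0; rewrite coef_skew_mul_top ?leqSpred //.
by rewrite mulf_neq0 ?iter_rmorph_eq0 // -/(lead_coef _) lead_coef_eq0.
Qed.

Lemma skew_mul_eq0 A B : A * B = 0 -> A = 0 \/ B = 0.
Proof.
have [|A0] := classic (A = 0); first by left.
have [|B0 AB0] := classic (B = 0); first by right.
by have := skew_mul_coef_neq0 A0 B0; rewrite AB0 coef0 eqxx.
Qed.

Lemma size_skew_mul A B : A <> 0 -> B <> 0 ->
  sz (A * B) =
  ((sz A).-1 + (sz B).-1).+1.
Proof.
move=> A0 B0; apply/eqP; rewrite eqn_leq size_skew_mul_leq ?leqSpred //=.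
rewrite ltnNge; apply: contra (skew_mul_coef_neq0 A0 B0) => leAB.
by rewrite nth_default.
Qed.

Lemma skew_edivp A f : A <> 0 ->
  exists q g : skew_poly s,
    f = q * A + g /\ (sz g < sz A)%N.
Proof.
move=> A0; have [n] := ubnP (sz f); elim: n f => // n IHn f.
rewrite ltnS => sf; have [ltfA|leAf] := ltnP (sz f) (sz A).
  by exists 0, f; rewrite mul0r add0r.
have sA : (0 < sz A)%N by rewrite size_poly_gt0; exact/eqP.
set a := (sz A).-1.
set k := (sz f - sz A)%N.
have fE : sz f = (k + a).+1 by rewrite -addnS prednK // subnK.
(* Moving [X^k] past the leading coefficient of [A] twists it by [iter k s]; hence this divisor. *)
pose c := (f : {poly F})`_(k + a) / iter k s (A : {poly F})`_a.
pose m : skew_poly s := (c *: 'X^k : {poly F}).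
have sm : (sz m <= k.+1)%N.
  by rewrite (leq_trans (size_scale_leq _ _)) // size_polyXn.
have sA' : (sz A <= a.+1)%N by rewrite leqSpred.
have [|q [g [gE sg]]] := IHn (f - m * A).
  apply: leq_trans sf; rewrite fE ltnS; apply/leq_sizeP => i.
  rewrite leq_eqVlt => /predU1P[<-|lt_i].
    rewrite [LHS]coefB coef_skew_mul_top // coefZ coefXn eqxx mulr1.
    rewrite /c divfK ?subrr //.
    by rewrite iter_rmorph_eq0 -/(lead_coef _) lead_coef_eq0; exact/eqP.
  rewrite [LHS]coefB !nth_default ?subrr ?fE //.
  by rewrite (leq_trans (size_skew_mul_leq sm sA')).
exists (m + q), g; split=> //.
by rewrite mulrDl -addrA -gE addrC subrK.
Qed.

(** By Euclidean division, a nonzero element of least degree generates a nonzero left ideal; descent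
    on the size finds one. *)
Lemma skew_left_pid : left_pid (skew_poly s).
Proof.
split; first exact: skew_mul_eq0.
move=> J [J0 JD JM].
have [[d0 [Jd0 d0n0]]|noJ] := classic (exists d, J d /\ d <> 0); last first.
  exists 0 => // f Jf; exists 0; rewrite mul0r; apply: NNPP => f0.
  by apply: noJ; exists f.
suff [d [Jd dn0 dmin]] : exists d, [/\ J d, d <> 0 & forall g, J g ->
    (sz g < sz d)%N -> g = 0].
  exists d => // f Jf; have [q [g [fE sg]]] := skew_edivp f dn0.
  exists q; rewrite fE [g]dmin ?addr0 //.
  have -> : g = f + (- q) * d by rewrite fE mulNr addrAC subrr add0r.
  by apply: JD => //; exact: JM.
have [n] := ubnP (sz d0); elim: n d0 Jd0 d0n0 => // n IHn d Jd dn0.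
rewrite ltnS => sd.
have [[g [Jg gn0 sg]]|nog] := classic (exists g, [/\ J g, g <> 0 &
    (sz g < sz d)%N]).
  by apply: (IHn g) => //; exact: leq_trans sg sd.
exists d; split=> // g Jg sg; apply: NNPP => gn0; apply: nog; by exists g.
Qed.

End SkewDivision.

(** * Central skew polynomials and annihilators *)

Section SkewCoefficients.

Variables (F : fieldType) (s : {rmorphism F -> F}).
Implicit Types (A B f g : skew_poly s) (c : F).
Local Notation sz A := (size (A%R : {poly F})).
Local Notation X := ('X%R : skew_poly s).
Local Notation "c %:S" := (c%:P%R : skew_poly s) (at level 1, format "c %:S").

Lemma coef_skewCM c A i : (c%:S * A : {poly F})`_i = c * A`_i.
Proof.
rewrite [LHS](coef_skew_mul s) big_ord_recl subn0 coefC eqxx /=.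
by rewrite big1 ?addr0 // => j _; rewrite coefC mul0r.
Qed.

Lemma coef_skewMC c A i : (A * c%:S : {poly F})`_i = A`_i * iter i s c.
Proof.
rewrite [LHS](coef_skew_mul_rev s) big_ord_recl subn0 coefC eqxx /=.
by rewrite big1 ?addr0 // => j _; rewrite coefC iter_rmorph0 mulr0.
Qed.

Lemma coef_skewMX A i :
  (A * X : {poly F})`_i = if i is j.+1 then A`_j else 0.
Proof.
rewrite [LHS](coef_skew_mul_rev s); case: i => [|i].
  by rewrite big_ord1 coefX iter_rmorph0 mulr0.
rewrite 2!big_ord_recl big1 ?addr0 => [|j _]; rewrite coefX;
  rewrite ?iter_rmorph0 ?mulr0 //=.
by rewrite add0r subSS subn0 coefX /= -/(iter i.+1 s 1) iter_rmorph1 mulr1.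
Qed.

Lemma coef_skewXM A i :
  (X * A : {poly F})`_i = if i is j.+1 then s A`_j else 0.
Proof.
rewrite [LHS](coef_skew_mul s); case: i => [|i].
  by rewrite big_ord1 coefX mul0r.
rewrite 2!big_ord_recl big1 ?addr0 => [|j _]; rewrite coefX ?mul0r //=.
by rewrite add0r subSS subn0 coefX /= mul1r.
Qed.

Lemma skew_polyE A : exists t, A = t * X + (A`_0)%:S.
Proof.
exists (\poly_(i < sz A) A`_i.+1 : {poly F}); apply/polyP => i.
rewrite [RHS]coefD coef_skewMX coefC; case: i => [|i]; rewrite ?add0r //=.
rewrite addr0 coef_poly; case: ltnP => // le_i.
by rewrite nth_default // leqW.
Qed.

(** Right multiplication by [X] twists no coefficient, so the usual induction on polynomials carries
    over. *)
Lemma skew_mulXE A : A * X = ((A : {poly F}) * 'X : {poly F}).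
Proof. by apply/polyP => i; rewrite coef_skewMX coefMX; case: i. Qed.

Lemma skew_poly_ind (K : skew_poly s -> Prop) :
  K 0 -> (forall A c, K A -> K (A * X + c%:S)) -> forall A, K A.
Proof.
move=> K0 KS; apply: poly_ind => // A c KA.
by have := KS A c KA; rewrite skew_mulXE.
Qed.

Lemma skew_central f : f * X = X * f -> (forall c, f * c%:S = c%:S * f) ->
  forall g, f * g = g * f.
Proof.
move=> fX fC; apply: skew_poly_ind => [|g c fg]; first by rewrite mulr0 mul0r.
by rewrite mulrDr mulrDl fC mulrA fg -!mulrA fX.
Qed.

Lemma skewCM c d : c%:S * d%:S = (c * d)%:S.
Proof.
by apply/polyP => i; rewrite coef_skewCM !coefC; case: eqP; rewrite ?mulr0.
Qed.

Lemma skew_const_invertible A : sz A = 1%N -> exists B, B * A = 1.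
Proof.
move=> /eqP /size_poly1P [c c0 ->]; exists (c^-1)%:S.
by rewrite skewCM mulVf.
Qed.

(** In [X = u A] the degrees add up to [1], so one factor is a nonzero constant, hence a unit; it
    has to be [u]. *)
Lemma rdvd_X A : ~ invertible A -> rdvd A X -> rdvd X A.
Proof.
move=> nA [u XE].
have X0 : X <> 0 by apply/eqP; rewrite polyX_eq0.
have u0 : u <> 0 by move=> u0; rewrite u0 mul0r in XE.
have A0 : A <> 0 by move=> A0; rewrite A0 mulr0 in XE.
have := size_skew_mul u0 A0; rewrite -XE size_polyX => -[suA].
have [su|] : sz u = 1%N \/ sz A = 1%N.
- move: suA; move/eqP: u0; move/eqP: A0; rewrite -!size_poly_gt0.
  case: (sz u) => [|[|k]]; case: (sz A) => [|[|l]] //; [by left.. |by right|].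
  by rewrite /= addSn addnS.
- have [v vu] := skew_const_invertible su.
  by exists v; rewrite XE mulrA vu mul1r.
move=> /skew_const_invertible [v vA]; case: nA.
exact: (left_inverse_invertible (skew_left_pid s) vA).
Qed.

(** The annihilator of [S / S A]: as [S] is not commutative, killing the class of [1] is not
    enough. *)
Definition annihilates A f := forall g, rdvd A (f * g).

Lemma left_ideal_annihilates A : left_ideal (annihilates A).
Proof.
split=> [g|x y Ax Ay g|x y Ay g]; first by rewrite mul0r; exact: rdvd0.
  by rewrite mulrDl; exact: rdvdD.
by rewrite -mulrA; exact: rdvd_mull.
Qed.

Lemma rdvd_annihilates A f : annihilates A f -> rdvd A f.
Proof. by move/(_ 1); rewrite mulr1. Qed.

End SkewCoefficients.

(** * Central elements over a finite field, for a twist of finite order *)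

Section SkewCenter.

Variables (F : finFieldType) (s : {rmorphism F -> F}) (m : nat).
Hypotheses (m_gt0 : (0 < m)%N) (s_m : forall x, iter m s x = x).
Implicit Types (A B f g h : skew_poly s) (c : F).
Local Notation sz A := (size (A%R : {poly F})).
Local Notation X := ('X%R : skew_poly s).
Local Notation "c %:S" := (c%:P%R : skew_poly s) (at level 1, format "c %:S").

Lemma skew_mulX_swap h : exists g, h * X = X * g.
Proof.
elim/skew_poly_ind: h => [|h c [g hX]]; first by exists 0; rewrite mul0r mulr0.
(* [iter m.-1 s] is the inverse of [s]. *)
exists (g * X + (iter m.-1 s c)%:S).
rewrite mulrDr mulrDl hX !mulrA [X * _%:P]skew_mulXC.
by rewrite -iterS prednK // s_m.
Qed.

Lemma skew_Xmul_swap h : exists g, X * h = g * X.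
Proof.
elim/skew_poly_ind: h => [|h c [g hX]]; first by exists 0; rewrite mul0r mulr0.
exists (g * X + (s c)%:S).
by rewrite mulrDr mulrDl mulrA hX [X * _%:P]skew_mulXC.
Qed.

Lemma skewXn_central g : X ^+ m * g = g * X ^+ m.
Proof.
apply: skew_central => [|c]; first by rewrite -exprS -exprSr.
(* Writing the second [c] as [iter m s c] leaves [X^m c = s^m(c) X^m], which induction on [m]
   proves. *)
rewrite -{2}[c]s_m; elim: m => [|k IHk]; first by rewrite !expr0 mul1r mulr1.
by rewrite exprS -mulrA IHk mulrA [X * _%:P]skew_mulXC -mulrA.
Qed.

(** From [x X^k + y B = 1] and [X x = g X] comes [X = g X^(k+1) + X y B], so [B] cannot right-divide
    [X^(k+1)] without right-dividing [X]. *)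
Lemma not_rdvd_Xn B k : irreducible B -> ~ rdvd B X -> ~ rdvd B (X ^+ k).
Proof.
move=> irrB nBX; elim: k => [|k nBk].
  exact: (irreducible_not_rdvd1 (skew_left_pid s) irrB).
move=> BXk; apply: nBX.
have [x [y xy]] := irreducible_bezout (skew_left_pid s) irrB nBk.
have [g gE] := skew_Xmul_swap x.
rewrite -[X](@mulr1 (skew_poly s)) -xy mulrDr !mulrA gE -!mulrA -exprS.
by apply: rdvdD; apply: rdvd_mull => //; exact: rdvd_mulr.
Qed.

(** With [x X + y A = 1] and [g x X = X h], each [g] is [X h] modulo [S A]: [X] acts surjectively on
    [S / S A]. *)
Lemma annihilates_divX A f : irreducible A -> ~ rdvd A X ->
  annihilates A (f * X) -> annihilates A f.
Proof.
move=> irrA nAX AfX g.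
have [x [y xy]] := irreducible_bezout (skew_left_pid s) irrA nAX.
have [h hE] := skew_mulX_swap (g * x).
rewrite -[g]mulr1 -xy !mulrDr !mulrA -(mulrA f) -(mulrA f) hE mulrA.
by apply: rdvdD; [exact: AfX | exact: rdvd_mulr].
Qed.

(** Finiteness of [F] enters here: the remainders modulo [A] lie in the finite list [vs], and
    killing them all means killing [S / S A]. *)
Lemma annihilates_separated A B : irreducible A -> irreducible B ->
  ~ ore_similar B A -> exists2 e, ~ rdvd B e & annihilates A e.
Proof.
move=> irrA irrB nBA; have A0 : A <> 0 by case: irrA.
pose vs := [seq (rVpoly v : skew_poly s) | v : 'rV[F]_(sz A)].
have [e nBe eA] :=
  not_similar_separated (skew_left_pid s) vs irrA irrB nBA.
exists e => // g; have [q [v [-> sv]]] := skew_edivp g A0.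
rewrite mulrDr mulrA; apply: rdvdD; first exact: rdvd_mulr.
apply: eA; apply/mapP; exists (poly_rV v); rewrite ?mem_enum //.
by rewrite poly_rV_K // ltnW.
Qed.

(* The annihilator of the simple module [S / S A], where [X] acts bijectively,
   is a two-sided ideal: its monic generator is central. *)
Lemma annihilates_central A B : irreducible A -> irreducible B ->
  ~ ore_similar B A -> ~ rdvd A X ->
  exists c : skew_poly s, [/\ forall f, c * f = f * c, rdvd A c & ~ rdvd B c].
Proof.
move=> irrA irrB nBA nAX.
have [e nBe Ae] := annihilates_separated irrA irrB nBA.
have [d0 Ad0 d0P] := proj2 (skew_left_pid s) _ (left_ideal_annihilates A).
have nBd0 : ~ rdvd B d0.
  by move=> Bd0; apply: nBe; apply: rdvd_trans Bd0 (d0P _ Ae).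
have d0n0 : d0 != 0 by apply/eqP => d00; apply: nBd0; rewrite d00; exact: rdvd0.
pose l := lead_coef (d0 : {poly F}).
have l0 : l != 0 by rewrite lead_coef_eq0.
pose d := (l^-1)%:S * d0.
have d0E : d0 = l%:S * d by rewrite mulrA skewCM mulfV // mul1r.
have nBd : ~ rdvd B d by move=> Bd; apply: nBd0; rewrite d0E; exact: rdvd_mull.
have Ad : annihilates A d.
  by case: (left_ideal_annihilates A) => _ _; apply.
have dn0 : d <> 0 by move=> d0'; apply: nBd; rewrite d0'; exact: rdvd0.
have dmin g : annihilates A g -> (sz g < sz d)%N -> g = 0.
  move=> /d0P [q gE] sg; apply: NNPP => g0.
  have {}gE : g = q * l%:S * d by rewrite -mulrA -d0E.
  have q0 : q * l%:S <> 0 by move=> q0; apply: g0; rewrite gE q0 mul0r.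
  move: sg; rewrite gE size_skew_mul // ltnNge => /negP; apply.
  by rewrite -[leqLHS]prednK ?size_poly_gt0 ?ltnS ?leq_addl //; exact/eqP.
set n := (sz d).-1.
have sd : sz d = n.+1 by rewrite prednK // size_poly_gt0; exact/eqP.
have dn1 : (d : {poly F})`_n = 1.
  rewrite coef_skewCM.
  have -> : n = (sz d0).-1.
    rewrite /n size_skew_mul ?size_polyC ?invr_eq0 ?l0 //; last exact/eqP.
    by apply/eqP; rewrite polyC_eq0 invr_eq0.
  exact: mulVf.
clearbody d.
(* [X] can be divided out of an annihilating [t X], which leaves a degree below that of [d]. *)
have dminX t : annihilates A (t * X) -> (sz (t * X) <= sz d)%N -> t = 0.
  move=> AtX stX; apply: NNPP => t0; apply: (t0).
  apply: dmin; first exact: annihilates_divX.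
  by move: stX; rewrite skew_mulXE size_mulX //; exact/eqP.
have d_0 : (d : {poly F})`_0 != 0.
  apply/eqP => d_0; have [t tE] := skew_polyE d; rewrite d_0 addr0 in tE.
  by apply: dn0; rewrite tE (@dminX t) ?mul0r // -tE.
have AN g h : annihilates A g -> annihilates A h -> annihilates A (g - h).
  by move=> Ag Ah f; rewrite mulrBl; exact: rdvdB.
have AMl g h : annihilates A g -> annihilates A (h * g).
  by move=> Ag f; rewrite -mulrA; exact: rdvd_mull.
have AMr g h : annihilates A g -> annihilates A (g * h).
  by move=> Ag f; rewrite -mulrA; exact: Ag.
(* The commutator has no constant term, so it is some [t X]; its top coefficient vanishes because
   [d] is monic and [s] fixes [1]. *)
have dX : d * X = X * d.
  apply/eqP; rewrite -subr_eq0; apply/eqP.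
  have [t] := skew_polyE (d * X - X * d).
  rewrite [_`_0]coefB coef_skewMX coef_skewXM subrr addr0 => tE.
  rewrite tE (@dminX t) ?mul0r // -tE.
    by apply: AN; [exact: AMr | exact: AMl].
  rewrite sd; apply/leq_sizeP => -[//|i] lt_i.
  rewrite [LHS]coefB coef_skewMX coef_skewXM.
  move: lt_i; rewrite ltnS leq_eqVlt => /predU1P[<-|lt_i].
    by rewrite dn1 rmorph1 subrr.
  by rewrite nth_default ?rmorph0 ?subrr // sd.
(* The twist by [iter n s] cancels the leading terms, so minimality makes the difference zero. *)
have dC' c : d * c%:S = (iter n s c)%:S * d.
  apply/eqP; rewrite -subr_eq0; apply/eqP; apply: dmin.
    by apply: AN; [exact: AMr | exact: AMl].
  rewrite sd ltnS; apply/leq_sizeP => i le_i.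
  rewrite [LHS]coefB coef_skewMC coef_skewCM.
  move: le_i; rewrite leq_eqVlt => /predU1P[<-|lt_i].
    by rewrite mulrC subrr.
  by rewrite nth_default ?mulr0 ?mul0r ?subrr // sd.
exists d; split=> //; last exact: rdvd_annihilates.
(* Comparing the constant terms in [dC'] and cancelling the nonzero one of [d] shows that [iter n s]
   fixes [c]. *)
apply: skew_central => // c; rewrite dC'; suff -> : iter n s c = c by [].
apply: (mulIf d_0).
have := congr1 (fun f : {poly F} => f`_0) (dC' c).
by rewrite coef_skewMC coef_skewCM mulrC.
Qed.

Lemma not_similar_central A B : irreducible A -> irreducible B ->
  ~ ore_similar B A ->
  exists c : skew_poly s, [/\ forall f, c * f = f * c, rdvd A c & ~ rdvd B c].
Proof.
move=> irrA irrB nBA; have [AX|] := classic (rdvd A X); last first.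
  exact: annihilates_central.
exists (X ^+ m); split; first exact: skewXn_central.
  by rewrite -(prednK m_gt0) exprSr; exact: rdvd_mull.
(* If [B] right-divided [X] too, both [A] and [B] would be associated to [X], hence similar. *)
apply: not_rdvd_Xn => // BX; apply: nBA.
apply/(ore_similarP (skew_left_pid s) irrB irrA); exists 1.
  exact: (irreducible_not_rdvd1 (skew_left_pid s) irrB).
rewrite mulr1; apply: rdvd_trans BX _.
by apply: rdvd_X => //; case: irrA.
Qed.

Lemma irreducible_swap A B : irreducible A -> irreducible B ->
  exists B' A', [/\ A * B = B' * A', irreducible B', irreducible A',
    ore_similar B' B & ore_similar A' A].
Proof.
move=> irrA irrB; have pidS := skew_left_pid s.
have [BA|nBA] := classic (ore_similar B A).
  (* Similar factors may stay in place: each already has the class required of it. *)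
  by exists A, B; split=> //; exact: ore_similar_sym.
have [c [cC Ac nBc]] := not_similar_central irrA irrB nBA.
exact: (irreducible_swap_central pidS irrA irrB cC).
Qed.

End SkewCenter.

(** * Reordering the factors *)

Section ReorderFactors.

Variables (S : nzRingType) (pidS : left_pid S).
Hypothesis swap : forall A B : S, irreducible A -> irreducible B ->
  exists B' A', [/\ A * B = B' * A', irreducible B', irreducible A',
    ore_similar B' B & ore_similar A' A].

(** Irreducibility is carried along because transitivity of similarity is available only for
    irreducible elements. *)
Let similar_irr (A B : S) :=
  [/\ irreducible A, irreducible B & ore_similar A B].

Let similar_irr_trans B A C :
  similar_irr A B -> similar_irr B C -> similar_irr A C.
Proof.
move=> [irrA irrB AB] [_ irrC BC]; split=> //.
exact: (ore_similar_trans pidS irrA irrB irrC).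
Qed.

(** The factor [x] passes the elements of [u] one at a time, from the right; each swap keeps both
    similarity classes. *)
Lemma move_factor_front (u t : seq S) (x y : S) :
  List.Forall2 similar_irr u t -> similar_irr x y ->
  exists x' u', [/\ (\prod_(z <- u) z) * x = x' * \prod_(z <- u') z,
    similar_irr x' y & List.Forall2 similar_irr u' t].
Proof.
move=> ut xy; elim: ut => [|z w {}u {}t zw _ [x' [u' [xE x'y u't]]]].
  by exists x, [::]; rewrite !big_nil mul1r mulr1.
have [irrz _ _] := zw; have [irrx' _ _] := x'y.
have [x2 [z2 [zxE irrx2 irrz2 x2x' z2z]]] := swap irrz irrx'.
exists x2, (z2 :: u'); split.
- by rewrite !big_cons -mulrA xE mulrA zxE mulrA.
- exact: similar_irr_trans x'y.
- by constructor=> //; exact: similar_irr_trans zw.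
Qed.

(** Induction on the target order [t]: the factor of [u] matched with the head of [t] is brought to
    the front, and the remaining factors are reordered. *)
Lemma reorder_factors (t s u : seq S) :
  perm_eq t s -> List.Forall2 similar_irr u s ->
  exists2 q, \prod_(z <- q) z = \prod_(z <- u) z & List.Forall2 similar_irr q t.
Proof.
elim: t s u => [|x t IHt] s u.
  rewrite perm_sym => /perm_nilP -> us; inversion us; subst.
  by exists [::].
move=> ts; have xs : x \in s by rewrite -(perm_mem ts) mem_head.
case/splitPr: xs ts => s1 s2 ts.
move=> /List.Forall2_app_inv_r [u1 [u' [us1 [us2 ->]]]].
inversion us2 as [|y ? u2 ? yx us2' ]; subst.
have [y' [u1' [yE y'x us1']]] := move_factor_front us1 yx.
have [|q qE qt] := IHt (s1 ++ s2) (u1' ++ u2) _ (List.Forall2_app us1' us2').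
  by rewrite -(perm_cons x) (perm_trans ts) // (perm_catCA s1 [:: x]).
exists (y' :: q); last by constructor.
by rewrite big_cons qE !big_cat big_cons /= !mulrA yE.
Qed.

End ReorderFactors.

Lemma Forall2_nth (T : Type) (R : T -> T -> Prop) (x0 : T) (q t : seq T) :
  List.Forall2 R q t ->
  forall i, (i < size t)%N -> R (nth x0 q i) (nth x0 t i).
Proof. by elim=> [|x y u v Rxy _ IH] [|i] //; exact: IH. Qed.

Theorem theorem2 (p a q r : nat) (hp : prime p) (ha : (0 < a)%N)
    (hq : q = (p ^ a)%N) (hr : (0 < r)%N)
    (F : finFieldType) (hF : #|F| = (q ^ r)%N)
    (sigma : {rmorphism F -> F}) (hsigma : forall x : F, sigma x = x ^+ q)
    (P : skew_poly sigma) (hP : P <> 0)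
    (n : nat) (Pf : 'I_n -> skew_poly sigma)
    (hirr : forall i : 'I_n, irreducible (Pf i))
    (hprod : P = \prod_(i < n) Pf i)
    (tau : 'S_n) :
  exists Q : 'I_n -> skew_poly sigma,
    [/\ forall i : 'I_n, irreducible (Q i),
        P = \prod_(i < n) Q i
      & forall i : 'I_n, ore_similar (Q i) (Pf (tau i))].
Proof.
have pidS := skew_left_pid sigma.
have sigma_iter k x : iter k sigma x = x ^+ (q ^ k).
  by elim: k => [|k IHk]; rewrite ?expr1 // iterS IHk hsigma -exprM expnSr.
(* A field with [q^r] elements satisfies [x^(q^r) = x], so [r] can serve as the exponent [m] for
   which [X^m] is central. *)
have sigma_r x : iter r sigma x = x by rewrite sigma_iter -hF expf_card.
pose s := [seq Pf i | i <- enum 'I_n].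
pose t := [seq Pf (tau i) | i <- enum 'I_n].
have ts : perm_eq t s.
  rewrite /t (map_comp Pf tau); apply: perm_map.
  apply: uniq_perm; rewrite ?enum_uniq ?(map_inj_uniq perm_inj) ?enum_uniq //.
  move=> i; rewrite mem_enum; apply/mapP.
  exists (tau^-1%g i); rewrite ?mem_enum //.
  by rewrite permKV.
have ss : List.Forall2
    (fun A B => [/\ irreducible A, irreducible B & ore_similar A B]) s s.
  rewrite /s; elim: (enum _) => [|i e IHe] /=; constructor=> //.
  by split=> //; exact: ore_similar_refl.
have [Q QE Qt] := reorder_factors pidS (irreducible_swap hr sigma_r) ts ss.
have st : size t = n by rewrite size_map size_enum_ord.
have sQ : size Q = n by rewrite -st; exact: List.Forall2_length Qt.
have {}Qt (i : 'I_n) :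
    irreducible (nth 0 Q i) /\ ore_similar (nth 0 Q i) (Pf (tau i)).
  have [|irrQ _ simQ] := Forall2_nth 0 Qt (i := i); first by rewrite st.
  split=> //; move: simQ; rewrite (nth_map i) ?size_enum_ord //.
  by rewrite nth_ord_enum.
exists (fun i : 'I_n => nth 0 Q i); split=> [i||i]; try by case: (Qt i).
transitivity (\prod_(z <- Q) z).
  by rewrite QE big_map hprod enumT [index_enum _]unlock.
by rewrite (big_nth (0 : skew_poly sigma)) sQ big_mkord.
Qed.
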